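(* Let $k\ge 2$ and $t\ge 3$ be integers, and let $G$ be a $k$-connected graph of order $n$ satisfying \[ \begin{cases} n\ge 6k+9-3t, & \text{if } 3\le t\le k+1,\\ n\ge 2k+t+3, & \text{if } t\ge k+2, \end{cases} \] and \[ \delta(G)\ge \left\lceil \frac{n+t}{2}\right\rceil . \] Then, for every pair of distinct vertices $u,v\in V(G)$ and every integer $s$ with $1\le s\le t$, there exist $s$ internally vertex-disjoint $(u,v)$-paths $P_1,\dots,P_s$ in $G$ such that $V(P_1\cup\cdots\cup P_s)=V(G)$ and $\kappa\bigl(G-E(P_1\cup\cdots\cup P_s)\bigr)\ge k$.
   Context: All graphs are finite, simple and undirected. $V(G)$ and $E(G)$ denote the vertex set and edge set of $G$, and $|V(G)|$ is the order of $G$. $\delta(G)$ is the minimum degree of $G$ and $\kappa(G)$ is its (vertex) connectivity; $G$ is $k$-connected if $\kappa(G)\ge k$. For $F\subseteq E(G)$, $G-F$ is the graph obtained from $G$ by deleting the edges of $F$ (keeping all vertices). A $(u,v)$-path is a path with end vertices $u$ and $v$ (the single edge $uv$ is allowed). The paths $P_1,\dots,P_s$ are $s$ distinct paths, and they are internally vertex-disjoint if any two of them share no vertices other than $u$ and $v$. *)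

(* Defs.v *)
From mathcomp Require Import all_boot.

Set Implicit Arguments.
Unset Strict Implicit.
Unset Printing Implicit Defensive.

(** A simple graph with vertex set the finite type [T]; its order is [#|T|]. *)
Record sgraph (T : finType) := SGraph {
  adj : rel T;
  adj_sym : symmetric adj;
  adj_irrefl : irreflexive adj }.

Section Graphs.
Variable T : finType.
Implicit Types (G : sgraph T) (F : {set {set T}}) (S : {set T}) (p : seq T).

Definition degree G (x : T) : nat := #|[set y | adj G x y]|.

(** Degrees are smaller than [#|T|], so the default value [#|T|] matters only
    when [T] is empty. *)
Definition min_degree G : nat := \big[minn/#|T|]_(x : T) degree G x.

(** Edges are represented as two-element sets of vertices. *)
Definition del_edges_adj G F : rel T :=
  fun x y => adj G x y && ([set x; y] \notin F).

Lemma del_edges_sym G F : symmetric (del_edges_adj G F).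
Proof. by move=> x y; rewrite /del_edges_adj adj_sym setUC. Qed.

Lemma del_edges_irrefl G F : irreflexive (del_edges_adj G F).
Proof. by move=> x; rewrite /del_edges_adj adj_irrefl. Qed.

(** [G - F] *)
Definition del_edges G F : sgraph T :=
  SGraph (@del_edges_sym G F) (@del_edges_irrefl G F).

(** Adjacency in [G - S]; the deleted vertices stay in [T] as isolated points,
    so [disconnects] only looks at vertices outside [S]. *)
Definition del_vertices_adj G S : rel T :=
  fun x y => [&& x \notin S, y \notin S & adj G x y].

Definition disconnects G S : bool :=
  [exists x, exists y,
    [&& x \notin S, y \notin S & ~~ connect (del_vertices_adj G S) x y]].

(** The connectivity is the least number of vertices whose deletion leaves a
    disconnected graph or at most one vertex; hence it is [n - 1] for the
    complete graph of order [n >= 1]. *)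
Definition kappa_cut G S : bool := disconnects G S || (#|~: S| <= 1).

Definition kappa G : nat :=
  #|[arg min_(S < [set: T] | kappa_cut G S) #|S|]|.

Definition k_connected (k : nat) G : Prop := k <= kappa G.

(** A path is given by the sequence of all its vertices, listed from [u] to
    [v]; for [u != v] distinct sequences are distinct paths. *)
Definition is_path G (u v : T) p : bool :=
  if p is x :: q
  then [&& x == u, last x q == v, path (adj G) x q & uniq p] else false.

Definition path_vertices p : {set T} := [set x in p].

Definition path_edges p : {set {set T}} :=
  [set [set xy.1; xy.2] | xy in zip p (behead p)].

Definition internally_disjoint (u v : T) (s : nat) (P : 'I_s -> seq T) : Prop :=
  forall i j : 'I_s, i != j ->
    path_vertices (P i) :&: path_vertices (P j) \subset [set u; v].

End Graphs.

(* Main.v *)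
Require Import Defs.
From mathcomp Require Import all_boot.
From mathcomp Require Import zify.

Set Implicit Arguments.
Unset Strict Implicit.
Unset Printing Implicit Defensive.

(** Write n for the order, d for the minimum degree (so 2d >= n + t) and N(x)
    for the neighbourhood of x.

    The paths. Let W be a set of s - 2 common neighbours of u and v, and take
    the s - 2 paths u - w - v with w in W together with the two halves of a
    Hamiltonian cycle of G - W, cut at u and v; for s = 1, W is empty and a
    Hamiltonian path from u to v is taken.  Since 2d >= n + t, the vertices u
    and v have at least t common neighbours, two more than are required, and
    the Dirac-type argument of [ore_walk] still works when the edges of a
    matching m are forbidden to the cycle.  These are the two degrees of
    freedom by which the connectivity is saved.

    The connectivity. Suppose that the deletion leaves a separation with sides
    A and B and fewer than k other vertices.  All edges of G between A and B
    lie on the paths, so that every vertex other than u and v has at most two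
    neighbours in G on the opposite side, and u and v have few besides W.
    Such pairs (A, B) are the weak pairs below.  By the degree condition both
    sides have at least d - k vertices, and the lower bound on n makes the
    weak pairs laminar: after exchanging the sides of some of them, no side A
    of a weak pair meets a side B of another ([weak_pairs_dichotomy],
    [same_sides_trans]).  Hence one set X contains all the sides A and its
    complement contains all the sides B.  As G is k-connected, no set of fewer
    than k vertices covers the edges between X and its complement, so these
    edges include a matching m that no such set covers ([koenig_matching]).
    Paths that avoid m then leave, for each weak pair (A, B), an edge of m
    between A and B, and no separation survives.

    The argument is used twice.  In [star_removal] it is applied to the pairs
    whose crossing edges all join u or v to t fixed common neighbours; there m
    has at most one edge at each of u and v, and W is chosen off their two
    partners, so that deleting the edges between u, v and W leaves a
    k-connected graph.  In [path_system_k_connected] it is applied inside that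
    graph with W fixed, which yields the matching that the Hamiltonian cycle
    has to avoid.  Fixing W first matters: a vertex u with many neighbours on
    both sides could otherwise belong to a side A for one choice of W and to a
    side B for another. *)

(** * Connectivity and separations *)

Section Connectivity.
Variables (T : finType) (G : sgraph T) (k : nat).

Lemma kappa_cut_leq (S : {set T}) : kappa_cut G S -> kappa G <= #|S|.
Proof.
move=> cutS; rewrite /kappa; case: arg_minnP => [|S0 _ minS0]; last exact: minS0.
by rewrite /kappa_cut setCT cards0 orbT.
Qed.

Lemma kappa_attained : exists2 S, kappa_cut G S & #|S| = kappa G.
Proof.
rewrite /kappa; case: arg_minnP => [|S cutS _]; last by exists S.
by rewrite /kappa_cut setCT cards0 orbT.
Qed.

(** The converse, up to complete graphs, is [k_connected_of_separations]; both
    replace vertex cuts by pairs of sides, which can be compared when the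
    edge set varies. *)
Lemma separation_card (A B : {set T}) (a b : T) :
  k_connected k G -> [disjoint A & B] -> a \in A -> b \in B ->
  {in A & B, forall x y, ~~ adj G x y} -> k <= #|~: (A :|: B)|.
Proof.
move=> Gk dAB aA bB noAB; apply: leq_trans Gk (kappa_cut_leq _).
apply/orP; left; apply/existsP; exists a; apply/existsP; exists b.
rewrite !inE aA bB orbT /=.
have clA : closed (del_vertices_adj G (~: (A :|: B))) A.
  apply: intro_closed; first apply: sym_connect_sym => x y.
    by rewrite /del_vertices_adj adj_sym andbCA.
  move=> x y; rewrite /del_vertices_adj !inE !negbK => /and3P[_ yAB xy] xA.
  case/orP: yAB => // yB; by have := noAB _ _ xA yB; rewrite xy.
apply/negP=> /(closed_connect clA); rewrite aA => /esym bA.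
by move/pred0P/(_ b): dAB; rewrite /= bA bB.
Qed.

(** The sides are a component of what a minimum cut leaves and the union of
    the other components. *)
Lemma k_connected_of_separations :
  k < #|T| ->
  (forall (A B : {set T}) (a b : T), [disjoint A & B] -> a \in A -> b \in B ->
     {in A & B, forall x y, ~~ adj G x y} -> k <= #|~: (A :|: B)|) ->
  k_connected k G.
Proof.
move=> kT sepk; rewrite /k_connected; case: kappa_attained => S + <-.
case/orP=> [|cS]; last by have := cardsC S; lia.
case/existsP=> a /existsP[b /and3P[aS bS nab]].
set e := del_vertices_adj G S in nab.
pose A := [set x | connect e a x]; pose B := ~: (A :|: S).
have AS : [disjoint A & S].
  apply/pred0P=> x /=; rewrite inE; apply/negP=> /andP[/connectP[p ep ->]] {x}.
  case/lastP: p ep => [|p x]; first by rewrite (negPf aS).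
  by rewrite rcons_path last_rcons => /andP[_ /and3P[_ /negPf->]].
have -> : S = ~: (A :|: B).
  apply/setP=> x; rewrite !(inE, negb_or, negbK).
  move/pred0P/(_ x): AS; rewrite !inE.
  by case: connect; case: (x \in S).
apply: (sepk A B a b).
- by apply/pred0P=> x; rewrite !inE; case: connect.
- by rewrite inE connect0.
- by rewrite !inE negb_or nab bS.
move=> x y xA; rewrite !inE negb_or => /andP[nay yS]; apply: contra nay => xy.
have xS : x \notin S by have /pred0P/(_ x) := AS; rewrite /= xA => /negbT.
move: xA; rewrite inE => /connect_trans; apply; apply: connect1.
by rewrite /e /del_vertices_adj xS yS.
Qed.

End Connectivity.

(** * Matchings without small vertex covers *)

(** The two sets on the left are the two ways of uncrossing [Z1] and [Z2] as
    vertex covers of a bipartite graph with part [X]. *)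
Lemma card_uncross (T : finType) (X Z1 Z2 : {set T}) :
  #|(Z1 :&: Z2 :&: X) :|: ((Z1 :|: Z2) :\: X)|
    + #|((Z1 :|: Z2) :&: X) :|: ((Z1 :&: Z2) :\: X)| = #|Z1| + #|Z2|.
Proof.
set Ya := (_ :&: X) :|: _; set Yb := (_ :&: X) :|: _.
rewrite -(cardsID X Ya) -(cardsID X Yb).
have -> : Ya :&: X = Z1 :&: Z2 :&: X.
  by apply/setP=> x; rewrite !inE; case: (x \in X); rewrite ?andbT ?andbF ?orbF.
have -> : Ya :\: X = (Z1 :|: Z2) :\: X.
  by apply/setP=> x; rewrite !inE; case: (x \in X); rewrite ?andbT ?andbF ?orbF.
have -> : Yb :&: X = (Z1 :|: Z2) :&: X.
  by apply/setP=> x; rewrite !inE; case: (x \in X); rewrite ?andbT ?andbF ?orbF.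
have -> : Yb :\: X = (Z1 :&: Z2) :\: X.
  by apply/setP=> x; rewrite !inE; case: (x \in X); rewrite ?andbT ?andbF ?orbF.
have := cardsID X (Z1 :|: Z2); have := cardsID X (Z1 :&: Z2).
have := cardsUI Z1 Z2; lia.
Qed.

(** Koenig's theorem, in the form that every small set misses an edge of the
    matching.  Following Lovasz, [M] is a minimal set of edges without a cover
    of fewer than [k] vertices.  If two edges of [M] shared a vertex, each
    would be missed by a cover of the other edges with fewer than [k] vertices.
    Uncrossing these two covers gives a cover of [M], and a set that covers [M]
    as soon as the shared vertex is added, so their sizes sum to at least
    [2k - 1]; but the sum is at most [2k - 2]. *)
Lemma koenig_matching (T : finType) (r : rel T) (X : {set T}) (k : nat) :
  (forall Z : {set T}, #|Z| < k ->
     exists x y, [/\ x \in X :\: Z, y \in ~: X :\: Z & r x y]) ->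
  exists M : {set T * T},
    [/\ forall x y, (x, y) \in M -> [/\ x \in X, y \notin X & r x y],
        forall x y z, (x, y) \in M -> (x, z) \in M -> y = z,
        forall x y z, (y, x) \in M -> (z, x) \in M -> y = z
      & forall Z : {set T}, #|Z| < k ->
          exists x y, [/\ (x, y) \in M, x \notin Z & y \notin Z]].
Proof.
move=> noCover.
pose covers (E : {set T * T}) (Z : {set T}) :=
  [forall p in E, (p.1 \in Z) || (p.2 \in Z)].
pose robust E := [forall Z : {set T}, covers E Z ==> (k <= #|Z|)].
pose E0 := [set p : T * T | [&& p.1 \in X, p.2 \notin X & r p.1 p.2]].
have robE0 : robust E0.
  apply/forallP=> Z; apply/implyP=> /forallP covZ; rewrite leqNgt; apply/negP.
  case/noCover=> x [y [/setDP[xX xZ] /setDP[]]]; rewrite inE => yX yZ rxy.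
  by have := covZ (x, y); rewrite inE /= xX yX rxy (negPf xZ) (negPf yZ).
have [M minM sME0] := minset_exists robE0.
have robM := minsetp minM.
have ME0 p : p \in M -> [/\ p.1 \in X, p.2 \notin X & r p.1 p.2].
  by move/(subsetP sME0); rewrite inE => /and3P.
have drop p : p \in M -> exists Z : {set T},
    [/\ #|Z| < k, p.1 \notin Z, p.2 \notin Z & covers (M :\ p) Z].
  move=> pM; have : ~~ robust (M :\ p).
    apply/negP=> rob; have := minsetinf minM rob (subsetDl _ _).
    by move/setP/(_ p); rewrite !inE eqxx pM.
  rewrite negb_forall => /existsP[Z]; rewrite negb_imply -ltnNge.
  case/andP=> cov ltk; exists Z.
  have : ~~ covers M Z.
    by apply/negP=> c; have /forallP/(_ Z)/implyP/(_ c) := robM; rewrite leqNgt ltk.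
  rewrite negb_forall => /existsP[q]; rewrite negb_imply negb_or.
  case/and3P=> qM q1 q2; have [qp|qp] := eqVneq q p; first by split=> //; rewrite -qp.
  have /forallP/(_ q) := cov; by rewrite !inE qp qM (negPf q1) (negPf q2).
have uncross (p1 p2 : T * T) : p1 \in M -> p2 \in M -> p1 <> p2 ->
    (p1.1 = p2.1 \/ p1.2 = p2.2) -> False.
  move=> p1M p2M p12 share.
  have [Z1 [k1 p1Z1 p1Z1' /forallP c1]] := drop _ p1M.
  have [Z2 [k2 p2Z2 p2Z2' /forallP c2]] := drop _ p2M.
  have := c1 p2; rewrite !inE eq_sym (introF eqP p12) p2M /= => c1p2.
  have := c2 p1; rewrite !inE (introF eqP p12) p1M /= => c2p1.
  have [p1X p1X' _] := ME0 _ p1M; have [p2X p2X' _] := ME0 _ p2M.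
  pose Ya := (Z1 :&: Z2 :&: X) :|: ((Z1 :|: Z2) :\: X).
  pose Yb := ((Z1 :|: Z2) :&: X) :|: ((Z1 :&: Z2) :\: X).
  have cardY : #|Ya| + #|Yb| = #|Z1| + #|Z2|.
    exact: card_uncross.
  have covM (Z : {set T}) :
      (forall q, q \in M -> (q.1 \in Z) || (q.2 \in Z)) -> k <= #|Z|.
    move=> c; have /forallP/(_ Z)/implyP := robM; apply.
    by apply/forallP=> q; apply/implyP; apply: c.
  have cov q : q \in M -> (q = p1 \/ (q.1 \in Z1) || (q.2 \in Z1)) /\
      (q = p2 \/ (q.1 \in Z2) || (q.2 \in Z2)).
    move=> qM; split.
      have [->|qp] := eqVneq q p1; first by left.
      by right; have := c1 q; rewrite !inE qp qM.
    have [->|qp] := eqVneq q p2; first by left.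
    by right; have := c2 q; rewrite !inE qp qM.
  (* The shared vertex lies in [X] in the first case: [Ya] is the cover, and
     [Yb] needs one more vertex. In the second case the roles are exchanged. *)
  case: share => share.
    have ka : k <= #|Ya|.
      apply: covM => q qM.
      have [qX qX' _] := ME0 _ qM; have [h1 h2] := cov _ qM.
      rewrite !inE qX (negPf qX') /= !andbT !andbF orbF.
      case: h1 => [->|h1]; first by move: c2p1; rewrite share (negPf p2Z2) /= => ->; rewrite ?orbT.
      case: h2 => [->|h2]; first by move: c1p2; rewrite -share (negPf p1Z1) /= => ->; rewrite ?orbT.
      by move: h1 h2; do 4!case: (_ \in _).
    have kb : k <= #|p1.1 |: Yb|.
      apply: covM => q qM.
      have [qX qX' _] := ME0 _ qM; have [h1 h2] := cov _ qM.
      rewrite !inE qX (negPf qX') /= !andbT !andbF orbF.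
      case: h1 => [->|h1]; first by rewrite eqxx.
      case: h2 => [->|h2]; first by rewrite share eqxx.
      by move: h1 h2; do 4!case: (_ \in _); rewrite ?orbT.
    by move: ka kb k1 k2 cardY; rewrite cardsU1; case: (_ \notin _); clear; lia.
  have kb : k <= #|Yb|.
    apply: covM => q qM.
    have [qX qX' _] := ME0 _ qM; have [h1 h2] := cov _ qM.
    rewrite !inE qX (negPf qX') /= !andbT !andbF orbF.
    case: h1 => [->|h1]; first by move: c2p1; rewrite share (negPf p2Z2') orbF => ->; rewrite ?orbT.
    case: h2 => [->|h2]; first by move: c1p2; rewrite -share (negPf p1Z1') orbF => ->; rewrite ?orbT.
    by move: h1 h2; do 4!case: (_ \in _).
  have ka : k <= #|p1.2 |: Ya|.
    apply: covM => q qM.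
    have [qX qX' _] := ME0 _ qM; have [h1 h2] := cov _ qM.
    rewrite !inE qX (negPf qX') /= !andbT !andbF orbF.
    case: h1 => [->|h1]; first by rewrite eqxx orbT.
    case: h2 => [->|h2]; first by rewrite share eqxx orbT.
    by move: h1 h2; do 4!case: (_ \in _); rewrite ?orbT.
  by move: ka kb k1 k2 cardY; rewrite cardsU1; case: (_ \notin _); clear; lia.
exists M; split=> [x y /ME0 //|x y z xy xz|x y z xy xz|Z Zk].
- have [//|/eqP yz] := eqVneq y z.
  by case: (uncross _ _ xy xz); [case|left].
- have [//|/eqP yz] := eqVneq y z.
  by case: (uncross _ _ xy xz); [case|right].
have : ~~ covers M Z.
  by apply/negP=> c; have /forallP/(_ Z)/implyP/(_ c) := robM; rewrite leqNgt Zk.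
rewrite negb_forall => /existsP[[x y]]; rewrite negb_imply negb_or /=.
by case/and3P=> ? ? ?; exists x, y.
Qed.

(** * A matching crossing a laminar family of separations *)

Section ProtectedMatching.
Variable T : finType.
Implicit Types p q : {set T} * {set T}.

Definition swap_sides p := (p.2, p.1).

Definition same_sides p q := [disjoint p.1 & q.2] && [disjoint p.2 & q.1].

(** Orient all members of the family as a fixed member [p0] is.  The union [X]
    of their first sides is then disjoint from all their second sides, and a
    cover of the edges leaving [X] separates [G].  An edge of the matching
    that avoids the vertices outside a member joins its two sides. *)
Lemma protected_matching (G : sgraph T) (k : nat) (F : pred ({set T} * {set T})) :
  k_connected k G ->
  (forall p, F p -> [/\ [disjoint p.1 & p.2], #|~: (p.1 :|: p.2)| < k,
                        k <= #|p.1| & k <= #|p.2|]) ->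
  (forall p, F p -> F (swap_sides p)) ->
  (forall p q, F p -> F q -> same_sides p q || same_sides p (swap_sides q)) ->
  (forall p q r, F p -> F q -> F r ->
     same_sides p q -> same_sides p r -> same_sides q r) ->
  exists m : rel T,
    [/\ symmetric m, subrel m (adj G), forall x y z, m x y -> m x z -> y = z
      & forall p, F p -> exists x y, [/\ x \in p.1, y \in p.2 & m x y]].
Proof.
move=> Gk Fsep Fswap Fdicho Ftrans.
case: (pickP F) => [p0 Fp0|F0]; last first.
  by exists (fun _ _ => false); split=> // p; rewrite F0.
pose X := \bigcup_(q | F q && same_sides p0 q) q.1.
have crossX q : F q -> same_sides p0 q -> q.1 \subset X /\ q.2 \subset ~: X.
  move=> Fq p0q; split; first by apply: (bigcup_max q) => //; rewrite Fq.
  rewrite -disjoints_subset.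
  apply/bigcup_disjointP=> r /andP[Fr p0r].
  by have /andP[_] := Ftrans _ _ _ Fp0 Fq Fr p0q p0r.
have p0p0 : same_sides p0 p0.
  by have [d _ _ _] := Fsep _ Fp0; rewrite /same_sides d disjoint_sym.
have [sX sY] := crossX _ Fp0 p0p0.
have [Z Zk|M [MX Ml Mr Mcov]] := @koenig_matching T (adj G) X k.
  have meets (C D : {set T}) : C \subset D -> k <= #|C| -> exists x, x \in D :\: Z.
    move=> CD kC; apply/set0Pn; rewrite setD_eq0; apply: contraTN Zk => DZ.
    by rewrite -leqNgt (leq_trans kC) // (leq_trans (subset_leq_card CD)) // subset_leq_card.
  have [_ _ k1 k2] := Fsep _ Fp0.
  have [a aX] := meets _ _ sX k1; have [b bY] := meets _ _ sY k2.
  have [/existsP[x /existsP[y /and3P[]]]|noE] :=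
    boolP [exists x, exists y, [&& x \in X :\: Z, y \in ~: X :\: Z & adj G x y]].
    by exists x, y.
  have : k <= #|~: (X :\: Z :|: ~: X :\: Z)|.
    apply: separation_card Gk _ aX bY _ => [|x y xX yY].
      by apply/pred0P=> x; rewrite /= !inE; case: (x \in X); rewrite ?andbF.
    apply: contra noE => xy; apply/existsP; exists x; apply/existsP; exists y.
    by rewrite xX yY.
  have -> : ~: (X :\: Z :|: ~: X :\: Z) = Z.
    by apply/setP=> x; rewrite !inE; case: (x \in X); case: (x \in Z).
  by rewrite leqNgt Zk.
exists (fun x y => ((x, y) \in M) || ((y, x) \in M)); split.
- by move=> x y; rewrite orbC.
- by move=> x y /orP[/MX[]//|/MX[_ _]]; rewrite adj_sym.
- move=> x y z /orP[xy|yx] /orP[xz|zx]; first exact: Ml xy xz.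
  + by have [xX _ _] := MX _ _ xy; have [_ /negP] := MX _ _ zx.
  + by have [xX _ _] := MX _ _ xz; have [_ /negP] := MX _ _ yx.
  exact: Mr yx zx.
have cross q : F q -> same_sides p0 q ->
    exists x y, [/\ x \in q.1, y \in q.2 & (x, y) \in M].
  move=> Fq p0q; have [s1 s2] := crossX _ Fq p0q; have [_ Sk _ _] := Fsep _ Fq.
  have [x [y [xy]]] := Mcov _ Sk; have [xX yX _] := MX _ _ xy.
  rewrite !inE !negbK => /orP[x1|x2]; last first.
    by have := subsetP s2 _ x2; rewrite inE xX.
  case/orP=> [y1|y2]; first by rewrite (subsetP s1) in yX.
  by exists x, y.
move=> q Fq; case/orP: (Fdicho _ _ Fp0 Fq) => p0q.
  by have [x [y [xq yq xy]]] := cross _ Fq p0q; exists x, y; rewrite xy.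
have [x [y [xq yq xy]]] := cross _ (Fswap _ Fq) p0q.
by exists y, x; rewrite xy orbT.
Qed.

End ProtectedMatching.

(** * Weak pairs are laminar *)

Section WeakPairs.
Variables (T : finType) (G : sgraph T) (k t d e : nat) (u v : T) (D : {set T}).
Hypotheses (ht : 3 <= t) (hk : 2 <= k).
Hypothesis hn_small : t <= k + 1 -> 6 * k + 9 <= #|T| + 3 * t.
Hypothesis hn_large : k + 2 <= t -> 2 * k + t + 3 <= #|T|.
Hypotheses (hd : #|T| + t <= 2 * d) (hdeg : forall x, d <= degree G x).
Hypotheses (hD : #|D| + e <= t) (he : e <= 2).

Implicit Types (x y z : T) (A B : {set T}) (p q : {set T} * {set T}).

Local Notation N x := [set y | adj G x y].

(** The number of edges from [x] to [B] that the deleted paths can contain: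
    [D] stands for the inner vertices of paths of length two, and [e] for the
    remaining paths through [u] and [v]. *)
Definition thin x B :=
  if x \in [set u; v] then #|(N x :&: B) :\: D| <= e else #|N x :&: B| <= 2.

Definition weak_pair p :=
  [&& [disjoint p.1 & p.2], p.1 != set0, p.2 != set0, #|~: (p.1 :|: p.2)| < k,
      [forall x in p.1, thin x p.2] & [forall x in p.2, thin x p.1]].

Lemma weak_pair_swap p : weak_pair p -> weak_pair (swap_sides p).
Proof.
case/and5P=> dp n1 n2 sk /andP[t1 t2]; rewrite /weak_pair /= disjoint_sym setUC.
by rewrite dp n1 n2 sk t1 t2.
Qed.

Lemma degree_bound x A B (c : nat) :
  x \notin A -> #|N x :&: B| <= c -> ~: B \subset x |: A -> d <= #|A| + c.
Proof.
move=> xA Bc sBA; apply: leq_trans (hdeg x) _; rewrite /degree -(cardsID B) addnC.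
apply: leq_add => //; apply: subset_leq_card; apply/subsetP=> y.
rewrite !inE => /andP[yB xy]; have /(subsetP sBA) : y \in ~: B by rewrite inE.
by rewrite !inE => /orP[/eqP yx|//]; rewrite yx adj_irrefl in xy.
Qed.

Lemma thin_card x B : thin x B -> #|N x :&: B| <= t.
Proof.
rewrite /thin; case: ifP => _ xB; last by lia.
have := cardsID D (N x :&: B); have := subset_leq_card (subsetIr (N x :&: B) D).
move: hD xB; clear; lia.
Qed.

(** A vertex of the first side other than [u] and [v] has all but two of its
    neighbours in that side or outside the pair.  If the side consists of [u]
    and [v] only, it is too small for a vertex with at most [t] neighbours
    across, by the lower bounds on the order. *)
Lemma weak_pair_card p : weak_pair p -> d <= #|p.1| + 1 + #|~: (p.1 :|: p.2)|.
Proof.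
case/and5P=> dp /set0Pn[x xA] _ sk /andP[/forallP t1 _].
set S := ~: _ in sk *.
have AS (y : T) : y \in p.1 -> d <= #|p.1 :\ y :|: S| + #|N y :&: p.2|.
  move=> yA; apply: (@degree_bound y _ p.2) => //.
    by rewrite /S !inE eqxx yA.
  apply/subsetP=> z; rewrite /S !inE => zB; rewrite (negPf zB) orbF.
  by case: eqP; case: (z \in p.1).
have AS' y : y \in p.1 -> #|p.1 :\ y :|: S| < #|p.1| + #|S|.
  move=> yA; have := leq_of_leqif (leq_card_setU (p.1 :\ y) S).
    by rewrite (cardsD1 y p.1) yA; clear; lia.
have [sAuv|/subsetPn[y yA yuv]] := boolP (p.1 \subset [set u; v]); last first.
  have := AS _ yA; have := AS' _ yA; have := implyP (t1 y) yA.
  rewrite /thin (negPf yuv); clear; lia.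
have := AS _ xA; have := AS' _ xA; have := thin_card (implyP (t1 x) xA).
have := subset_leq_card sAuv; rewrite cards2.
move: hd ht hn_small hn_large sk; clear.
case: (u != v); have [] := leqP t (k + 1); lia.
Qed.

(** Adding [weak_pair_card] for both sides gives [2d <= n + |S| + 2] with [S]
    the set of fewer than [k] vertices outside the pair; so
    [t <= k + 1], and the bound on the order for small [t] applies. *)
Lemma weak_pair_bounds p :
  weak_pair p -> [/\ d <= #|p.1| + k, d <= #|p.2| + k & t <= k + 1].
Proof.
move=> wp; have := weak_pair_card wp; have := weak_pair_card (weak_pair_swap wp).
rewrite /= (setUC p.2); case/and5P: wp => dp _ _ sk _.
have := cardsC (p.1 :|: p.2); have := leq_card_setU p.1 p.2.
case=> _; rewrite dp => /eqP ->; move: hd sk; clear.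
by move=> *; split; lia.
Qed.

Lemma thin_opposite p x : weak_pair p -> x \in p.1 -> thin x p.2.
Proof. by case/and5P=> _ _ _ _ /andP[/forallP/(_ x)/implyP]. Qed.

Lemma degree_bound2 x B1 B2 (c1 c2 : nat) :
  x \notin B1 :|: B2 -> #|N x :&: B1| <= c1 -> #|N x :&: B2| <= c2 ->
  d < #|~: (B1 :|: B2)| + (c1 + c2).
Proof.
move=> xB b1 b2; rewrite (cardsD1 x) inE xB add1n ltnS.
apply: (@degree_bound x _ (B1 :|: B2)); first by rewrite in_setD1 eqxx.
  rewrite setIUr; apply: leq_trans (leq_of_leqif (leq_card_setU _ _)) _.
  exact: leq_add.
by apply/subsetP=> y; rewrite !inE; case: eqP.
Qed.

Lemma disjoint_notin A B x : [disjoint A & B] -> x \in A -> x \notin B.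
Proof. by move/pred0P/(_ x) => /= + xA; rewrite xA => /negbT. Qed.

(** Up to four neighbours each, [N(x)] avoids [p.2] and [q.2], and [N(y)]
    avoids [p.2] and [q.1].  The complements of these unions overlap only
    outside [q] and lie off [p.2], so that
    [2d + 2 <= |~: p.2| + (k - 1) + 8], which is impossible for this order. *)
Lemma weak_pairs_uncrossed p q x y : weak_pair p -> weak_pair q ->
  x \in p.1 :&: q.1 -> y \in p.1 :&: q.2 ->
  x \notin [set u; v] -> y \notin [set u; v] -> False.
Proof.
move=> wp wq /setIP[xp xq] /setIP[yp yq] xn yn.
have [_ b2 tk] := weak_pair_bounds wp.
have tx1 := thin_opposite wp xp; have tx2 := thin_opposite wq xq.
have ty1 := thin_opposite wp yp.
have /= ty2 := thin_opposite (weak_pair_swap wq) yq.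
move: tx1 tx2 ty1 ty2; rewrite /thin (negPf xn) (negPf yn) => tx1 tx2 ty1 ty2.
case/and5P: wp => dp _ _ _ _; case/and5P: wq => dq _ _ sq _.
have := degree_bound2 _ tx1 tx2; have := degree_bound2 _ ty1 ty2.
have yq1 : y \notin q.1 by apply: disjoint_notin yq; rewrite disjoint_sym.
rewrite !inE !negb_or (disjoint_notin dp xp) (disjoint_notin dp yp) yq1.
rewrite (disjoint_notin dq xq).
move=> /(_ isT) + /(_ isT).
have := cardsUI (~: (p.2 :|: q.1)) (~: (p.2 :|: q.2)).
have : #|~: (p.2 :|: q.1) :|: ~: (p.2 :|: q.2)| <= #|~: p.2|.
  by apply: subset_leq_card; apply/subsetP=> z; rewrite !inE; case: (z \in p.2).
have : #|~: (p.2 :|: q.1) :&: ~: (p.2 :|: q.2)| <= #|~: (q.1 :|: q.2)|.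
  apply: subset_leq_card; apply/subsetP=> z; rewrite !inE.
  by case: (z \in p.2); case: (z \in q.1).
have sn := hn_small tk; have := cardsC p.2; move: sn hd b2 sq tk hk; clear; lia.
Qed.

(** A vertex [u] or [v] on opposite sides of [p] and [q] would have at most
    [|D| + 2e] neighbours in [p.2] and [q.1], two sets of at least [d - k]
    vertices that share at most one vertex.  This is where [D] has to be the
    same for both pairs. *)
Lemma weak_pairs_unambiguous p q : weak_pair p -> weak_pair q ->
  p.2 :&: q.1 \subset [set u; v] -> p.1 :&: q.2 \subset [set u; v] ->
  [disjoint p.1 & q.2].
Proof.
move=> wp wq s1 s2; apply/pred0P=> x /=; apply/negP=> /andP[xp xq].
have xuv : x \in [set u; v] by apply: (subsetP s2); rewrite inE xp.
have [_ b2 tk] := weak_pair_bounds wp; have [b1 _ _] := weak_pair_bounds wq.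
have := thin_opposite wp xp; have /= := thin_opposite (weak_pair_swap wq) xq.
rewrite /thin xuv => t1 t2.
case/and5P: wp => dp _ _ _ _; case/and5P: wq => dq _ _ _ _.
have xU : x \notin p.2 :|: q.1.
  rewrite inE negb_or (disjoint_notin dp xp) /=.
  by apply: disjoint_notin xq; rewrite disjoint_sym.
have : #|(N x :&: (p.2 :|: q.1))| <= #|D| + (e + e).
  rewrite -(cardsID D); apply: leq_add; first exact/subset_leq_card/subsetIr.
  rewrite setIUr setDUl; apply: leq_trans (leq_of_leqif (leq_card_setU _ _)) _.
  exact: leq_add.
have nx : x \notin ~: (p.2 :|: q.1) :\ x by rewrite in_setD1 eqxx.
move=> /(degree_bound nx) nD.
have {nD}: d <= #|~: (p.2 :|: q.1) :\ x| + (#|D| + (e + e)).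
  by apply: nD; apply/subsetP=> y; rewrite !inE; case: eqP.
have : #|p.2 :&: q.1| <= 1.
  have : #|p.2 :&: q.1| <= #|[set u; v] :\ x|.
    apply: subset_leq_card; apply/subsetP=> y yI; rewrite in_setD1 (subsetP s1) // andbT.
    apply: contraNneq xU => <-; move: yI.
    by rewrite !inE => /andP[->].
  have := cardsD1 x [set u; v]; rewrite xuv cards2; case: (u != v); clear; lia.
have := cardsD1 x (~: (p.2 :|: q.1)); rewrite inE xU.
have := cardsUI p.2 q.1; have := cardsC (p.2 :|: q.1).
have sn := hn_small tk; move: sn hd b1 b2 tk hk hD he; clear; lia.
Qed.

(** The side [p.1] is too large to meet both sides of [q] in [u] and [v] only,
    so it meets [q.1] in another vertex; by uncrossing, [p.2] does not. *)
Lemma weak_pairs_same_sides p q : weak_pair p -> weak_pair q ->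
  p.1 :&: q.2 \subset [set u; v] -> same_sides p q.
Proof.
move=> wp wq s12; have s21 : p.2 :&: q.1 \subset [set u; v].
  have [x xI xn] : exists2 x, x \in p.1 :&: q.1 & x \notin [set u; v].
    apply/subsetPn/negP=> s11; have [b1 _ tk] := weak_pair_bounds wp.
    have : #|p.1| <= #|~: (q.1 :|: q.2) :|: [set u; v]|.
      apply: subset_leq_card; apply/subsetP=> x xp.
      have [xq1|xq1] := boolP (x \in q.1).
        by rewrite inE (subsetP s11) ?orbT // inE xp.
      have [xq2|xq2] := boolP (x \in q.2).
        by rewrite inE (subsetP s12) ?orbT // inE xp.
      by rewrite !inE negb_or xq1 xq2.
    have := leq_of_leqif (leq_card_setU (~: (q.1 :|: q.2)) [set u; v]).
    rewrite cards2; case/and5P: wq => _ _ _ sq _; have sn := hn_small tk.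
    by move: sn hd b1 tk hk sq; case: (u != v); clear; lia.
  apply/subsetP=> y; rewrite setIC => yI; apply: contraT => yn.
  by rewrite setIC in xI; have := weak_pairs_uncrossed wq wp xI yI xn yn.
rewrite /same_sides (weak_pairs_unambiguous wp wq) //=.
by rewrite disjoint_sym (weak_pairs_unambiguous wq wp) // setIC.
Qed.

Lemma weak_pairs_dichotomy p q : weak_pair p -> weak_pair q ->
  same_sides p q || same_sides p (swap_sides q).
Proof.
move=> wp wq; have [s12|/subsetPn[y yI yn]] := boolP (p.1 :&: q.2 \subset [set u; v]).
  by rewrite weak_pairs_same_sides.
rewrite orbC weak_pairs_same_sides //; first exact: weak_pair_swap.
apply/subsetP=> x xI; apply: contraT => xn.
by have := weak_pairs_uncrossed wp wq xI yI xn yn.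
Qed.

(** Otherwise [q.1], [r.1] and [p.2] are pairwise disjoint, and three sets of
    at least [d - k] vertices exceed the order. *)
Lemma same_sides_trans p q r : weak_pair p -> weak_pair q -> weak_pair r ->
  same_sides p q -> same_sides p r -> same_sides q r.
Proof.
move=> wp wq wr /andP[_ pq] /andP[_ pr].
case/orP: (weak_pairs_dichotomy wq wr) => // /andP[/= qr _].
have [_ bp tk] := weak_pair_bounds wp.
have [bq _ _] := weak_pair_bounds wq; have [br _ _] := weak_pair_bounds wr.
have := max_card (mem (p.2 :|: (q.1 :|: r.1))).
have /leqifP := leq_card_setU q.1 r.1; rewrite qr => /eqP cqr.
have /leqifP := leq_card_setU p.2 (q.1 :|: r.1).
rewrite disjoint_sym disjoints_subset subUset -!disjoints_subset.
rewrite !(disjoint_sym _ p.2) pq pr => /eqP ->.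
rewrite cqr; have sn := hn_small tk.
by move: sn hd ht bp bq br; clear; lia.
Qed.

Lemma weak_pairs_matching (H : sgraph T) : k_connected k H ->
  exists m : rel T,
    [/\ symmetric m, subrel m (adj H), forall x y z, m x y -> m x z -> y = z
      & forall p, weak_pair p -> exists x y, [/\ x \in p.1, y \in p.2 & m x y]].
Proof.
move=> Hk; apply: (protected_matching Hk).
- move=> p wp; have [b1 b2 tk] := weak_pair_bounds wp.
  case/and5P: wp => dp _ _ sk _; have sn := hn_small tk.
  by split=> //; move: sn hd b1 b2 tk; clear; lia.
- exact: weak_pair_swap.
- exact: weak_pairs_dichotomy.
exact: same_sides_trans.
Qed.

(** The relation [h] bounds the edges of [G] that are missing in [H].  Both
    sides of a separation of [H] form a weak pair, and [H] has an edge of [m]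
    across it. *)
Lemma k_connected_of_sparse_removal (H : sgraph T) (h m : rel T) :
  k < #|T| -> symmetric h ->
  (forall x, x \notin [set u; v] -> #|[set y | h x y]| <= 2) ->
  (forall x, x \in [set u; v] -> #|[set y | h x y] :\: D| <= e) ->
  (forall x y, adj G x y -> ~~ adj H x y -> h x y) ->
  subrel m (adj H) ->
  (forall p, weak_pair p -> exists x y, [/\ x \in p.1, y \in p.2 & m x y]) ->
  k_connected k H.
Proof.
move=> kT hsym h2 hDe Gh mH mcross; apply: k_connected_of_separations => //.
move=> A B a b dAB aA bB noAB; rewrite leqNgt; apply/negP=> sk.
have thinh x (C : {set T}) : {in C, forall y, adj G x y -> h x y} -> thin x C.
  move=> Ch; have sub : N x :&: C \subset [set y | h x y].
    by apply/subsetP=> y; rewrite !inE => /andP[xy yC]; apply: Ch.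
  rewrite /thin; case: ifPn => [/hDe|/h2]; apply: leq_trans.
    exact/subset_leq_card/setSD.
  exact: subset_leq_card.
have /mcross[x [y [/= xA yB /mH]]] : weak_pair (A, B).
  apply/and5P; split=> //=; try by apply/set0Pn; eexists; eassumption.
  apply/andP; split; apply/forallP=> x; apply/implyP=> xAB; apply: thinh => y yAB xy.
    by apply: Gh => //; apply: noAB.
  by rewrite hsym; apply: Gh; [rewrite adj_sym|apply: noAB].
by rewrite (negPf (noAB _ _ xA yB)).
Qed.

End WeakPairs.

(** * Spanning walks from degree sums *)

Section Walks.
Variable T : eqType.
Implicit Types (x y a b u : T) (q r : seq T).

(** Consecutive pairs of the walk [u :: q]; such walks may be closed, with
    [last u q = u]. *)
Definition steps u q : seq (T * T) := pairmap pair u q.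

Lemma steps_cat u q r : steps u (q ++ r) = steps u q ++ steps (last u q) r.
Proof. exact: pairmap_cat. Qed.

Lemma steps_cons u y q : steps u (y :: q) = (u, y) :: steps y q.
Proof. by []. Qed.

Lemma steps_zip u q : steps u q = zip (u :: q) q.
Proof. by elim: q u => //= y q IHq u; rewrite IHq. Qed.

Lemma steps_fst u q : map fst (steps u q) = belast u q.
Proof. by elim: q u => //= y q IHq u; rewrite IHq. Qed.

Lemma steps_snd u q : map snd (steps u q) = q.
Proof. by elim: q u => //= y q IHq u; rewrite IHq. Qed.

Lemma path_steps (e : rel T) u q : path e u q = all (fun p => e p.1 p.2) (steps u q).
Proof. by elim: q u => //= y q IHq u; rewrite IHq. Qed.

Lemma last_rev_belast u q : last (last u q) (rev (belast u q)) = u.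
Proof. by case: q => //= y q; rewrite rev_cons last_rcons. Qed.

Lemma steps_rev u q :
  steps (last u q) (rev (belast u q)) = rev (map (fun p => (p.2, p.1)) (steps u q)).
Proof.
elim: q u => //= y q IHq u.
by rewrite !rev_cons -cats1 steps_cat IHq last_rev_belast cats1.
Qed.

Lemma perm_belast u q r :
  perm_eq q r -> last u q = last u r -> perm_eq (belast u q) (belast u r).
Proof.
move=> qr lqr; have : perm_eq (u :: q) (u :: r) by rewrite perm_cons.
by rewrite !lastI lqr -!cats1 perm_cat2r.
Qed.

Lemma steps_split u q a b :
  (a, b) \in steps u q -> exists q1 q2, q = q1 ++ b :: q2 /\ last u q1 = a.
Proof.
elim: q u => //= y q IHq u; rewrite inE => /orP[/eqP[-> ->]|/IHq[q1 [q2 [-> <-]]]].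
  by exists [::], q.
by exists (y :: q1), q2.
Qed.

Variable e : rel T.
Hypotheses (esym : symmetric e) (eirr : irreflexive e).

Definition gaps u q := count (fun p => ~~ e p.1 p.2) (steps u q).

Lemma gaps_rev u q : gaps (last u q) (rev (belast u q)) = gaps u q.
Proof.
rewrite /gaps steps_rev count_rev count_map; apply: eq_count => p /=.
by rewrite esym.
Qed.

(** Reversing the segment from [y] to [last y r] replaces the two steps around
    it and traverses the inner steps backwards. *)
Lemma gaps_reversal u q1 y r b q2 :
  e (last u q1) (last y r) -> e y b ->
  ~~ e (last u q1) y || ~~ e (last y r) b ->
  gaps u (q1 ++ rev (y :: r) ++ b :: q2) < gaps u (q1 ++ (y :: r) ++ b :: q2).
Proof.
move=> e1 e2 gap; have -> : rev (y :: r) = last y r :: rev (belast y r).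
  by rewrite lastI rev_rcons.
rewrite /gaps !(steps_cat, steps_cons, count_cat) /= last_rev_belast e1 e2 /=.
have := gaps_rev y r; rewrite /gaps => ->; move: gap.
by do 2!case: (e _ _) => //=; lia.
Qed.

(** Ore's argument, for closed walks (Hamiltonian cycles) and for walks with
    distinct ends (Hamiltonian paths) alike.  If the consecutive [x] and [y]
    are not adjacent, the degree sum yields another step [(a, b)] with [a]
    adjacent to [x] and [b] to [y]: the step [(x, y)] itself is counted in
    neither term.  Reversing the segment between the two steps replaces them
    by [(x, a)] and [(y, b)] and lowers the number of gaps.  The hypothesis is
    invariant because the ends and the multiset of vertices are kept. *)
Lemma ore_walk u q :
  (forall x y, size q <= count (e x) (belast u q) + count (e y) q) ->
  exists q', [/\ perm_eq q' q, last u q' = last u q & path e u q'].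
Proof.
have [n] := ubnP (gaps u q); elim: n q => // n IHn q; rewrite ltnS => gq degs.
have [pq|] := boolP (path e u q); first by exists q.
rewrite path_steps -has_predC => /hasP[[x y] xyq /= nxy].
have [[a b] abq /andP[/= xa yb]] :
    exists2 p, p \in steps u q & e x p.1 && e y p.2.
  apply/hasP; apply: contraT; rewrite has_count -leqNgt leqn0 => /eqP none.
  have := count_predUI (fun p => e x p.1) (fun p => e y p.2) (steps u q).
  rewrite [count (predI _ _) _]none.
  have -> : count (fun p => e x p.1) (steps u q) = count (e x) (belast u q).
    by rewrite -steps_fst count_map.
  have -> : count (fun p => e y p.2) (steps u q) = count (e y) q.
    by rewrite -[in RHS](steps_snd u q) count_map.
  have := count_predC (predU (fun p => e x p.1) (fun p => e y p.2)) (steps u q).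
  have : 0 < count (predC (predU (fun p => e x p.1) (fun p => e y p.2))) (steps u q).
    by rewrite -has_count; apply/hasP; exists (x, y); rewrite //= !eirr.
  rewrite size_pairmap; have := degs x y; lia.
have improve q1 z r c q2 : q = q1 ++ (z :: r) ++ c :: q2 ->
    e (last u q1) (last z r) -> e z c -> ~~ e (last u q1) z || ~~ e (last z r) c ->
    exists q', [/\ perm_eq q' q, last u q' = last u q & path e u q'].
  move=> Dq e1 e2 gap; set q' := q1 ++ rev (z :: r) ++ c :: q2.
  have q'q : perm_eq q' q.
    by rewrite Dq perm_cat2l perm_cat2r perm_rev.
  have lq' : last u q' = last u q by rewrite Dq !last_cat.
  have [||q'' [pq'' lq'' pa]] := IHn q'.
  - by apply: leq_trans gq; rewrite Dq gaps_reversal.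
  - move=> x' y'; apply: leq_trans (_ : size q <= _); first by rewrite (perm_size q'q).
    apply: leq_trans (degs x' y') _; rewrite leq_eqVlt; apply/orP; left; apply/eqP.
    congr (_ + _); last by apply/permP; rewrite perm_sym.
    by apply/permP; rewrite perm_sym perm_belast.
  by exists q''; rewrite (perm_trans pq'' q'q) lq'' lq'.
have [q1 [q2 [Dq lx]]] := steps_split xyq.
move: abq; rewrite {1}Dq steps_cat lx mem_cat steps_cons inE => /or3P[|/eqP[ax _]|].
- case/steps_split=> r1 [r2 [Dq1 la]].
  apply: (improve r1 b r2 y q2); rewrite ?la //.
  + by rewrite Dq Dq1 -catA.
  + by move: lx; rewrite Dq1 last_cat /= => ->; rewrite esym.
  + by rewrite esym.
  + by move: lx; rewrite Dq1 last_cat /= => ->; rewrite nxy orbT.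
- by rewrite ax eirr in xa.
case/steps_split=> r1 [r2 [Dq2 la]].
apply: (improve q1 y r1 b r2); rewrite ?lx ?la ?nxy //.
by rewrite Dq Dq2.
Qed.

(** Each vertex is left at most once and entered at most once, also in a closed
    walk, where only the common end is repeated. *)
Lemma steps_neighbours u q x (s : seq T) : uniq (belast u q) -> uniq q ->
  uniq s -> {subset s <= [pred y | ((x, y) \in steps u q) || ((y, x) \in steps u q)]} ->
  size s <= 2.
Proof.
move=> uq1 uq2 us sub.
pose s1 := [seq p.2 | p <- steps u q & p.1 == x].
pose s2 := [seq p.1 | p <- steps u q & p.2 == x].
apply: (@leq_trans (size (s1 ++ s2))).
  apply: uniq_leq_size => // y /sub; rewrite inE mem_cat => /orP[xy|yx]; apply/orP.
    by left; apply/mapP; exists (x, y); rewrite ?mem_filter ?eqxx.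
  by right; apply/mapP; exists (y, x); rewrite ?mem_filter ?eqxx.
rewrite size_cat !size_map !size_filter.
have -> : count (fun p => p.1 == x) (steps u q) = count_mem x (belast u q).
  by rewrite -steps_fst count_map.
have -> : count (fun p => p.2 == x) (steps u q) = count_mem x q.
  by rewrite -[in RHS](steps_snd u q) count_map.
by rewrite !count_uniq_mem //; case: (_ \in _); case: (_ \in _).
Qed.

End Walks.

(** * Systems of paths whose deletion preserves connectivity *)

Lemma subset_of_card (T : finType) (A : {set T}) n :
  n <= #|A| -> exists2 B : {set T}, B \subset A & #|B| = n.
Proof.
move=> nA; exists [set x in take n (enum A)].
  by apply/subsetP=> x; rewrite inE => /mem_take; rewrite mem_enum.
rewrite cardsE (card_uniqP _) ?size_takel -?cardE //.
by rewrite take_uniq // enum_uniq.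
Qed.

Lemma set2_inj (T : finType) (x y a b : T) :
  [set x; y] = [set a; b] -> x = a /\ y = b \/ x = b /\ y = a.
Proof.
move=> /setP E.
have := E x; have := E y; have := E a; have := E b; rewrite !inE !eqxx ?orbT /=.
do 4![case: eqP => [?|_] //=; subst]; rewrite ?eqxx; auto;
  by do ?[case: eqP => [?|_] //=; subst]; auto.
Qed.

Section PathSystem.
Variables (T : finType) (G : sgraph T) (k t d s : nat) (u v : T).
Hypotheses (ht : 3 <= t) (hk : 2 <= k).
Hypothesis hn_small : t <= k + 1 -> 6 * k + 9 <= #|T| + 3 * t.
Hypothesis hn_large : k + 2 <= t -> 2 * k + t + 3 <= #|T|.
Hypotheses (hd : #|T| + t <= 2 * d) (hdeg : forall x, d <= degree G x).
Hypotheses (uv : u != v) (s0 : 0 < s) (st : s <= t).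

Local Notation N x := [set y | adj G x y].

Definition star_adj (W : {set T}) : rel T :=
  fun x y => (x \in [set u; v]) && (y \in W) || (y \in [set u; v]) && (x \in W).

Definition star_edges (W : {set T}) : {set {set T}} :=
  [set E : {set T} | [exists x, exists y, star_adj W x y && (E == [set x; y])]].

Lemma star_adj_sym W : symmetric (star_adj W).
Proof. by move=> x y; rewrite /star_adj orbC. Qed.

Lemma star_edgesE W x y : ([set x; y] \in star_edges W) = star_adj W x y.
Proof.
rewrite inE; apply/existsP/idP=> [[a /existsP[b /andP[ab /eqP]]]|xy]; last first.
  by exists x; apply/existsP; exists y; rewrite xy eqxx.
by case/set2_inj=> -[-> ->]; rewrite // star_adj_sym.
Qed.

Lemma order_large : k < #|T| /\ s + 2 <= #|T|.
Proof.
have [tk|tk] := leqP t (k + 1).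
  by have := hn_small tk; move: tk st; clear; lia.
have := @hn_large; rewrite addn2 addn1 in tk * => /(_ tk); move: tk st hk; clear; lia.
Qed.

Lemma common_neighbours : t <= #|N u :&: N v|.
Proof.
have := cardsUI (N u) (N v); have := cardsC (N u :|: N v).
have := hdeg u; have := hdeg v; rewrite /degree; move: hd; clear; lia.
Qed.

Lemma matching_degree (m : rel T) x :
  (forall x y z, m x y -> m x z -> y = z) -> #|[set y | m x y]| <= 1.
Proof.
move=> mm; apply/card_le1_eqP=> y z; rewrite !inE => xy xz.
exact: mm xz xy.
Qed.

Lemma notin_star (W : {set T}) x :
  W \subset N u :&: N v -> x \in [set u; v] -> x \notin W.
Proof.
move=> WN; rewrite !inE => /orP[] /eqP->; apply/negP=> /(subsetP WN);
  by rewrite !inE adj_irrefl ?andbF.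
Qed.

(** Among [t] common neighbours [C] the matching obtained for [D = C] and
    [e = 0] has at most one partner of [u] and one of [v], and [t - 2 >= s - 2]
    elements of [C] remain for [W].  The matching then survives the deletion
    of the edges between [u], [v] and [W]. *)
Lemma star_removal : k_connected k G -> exists W : {set T},
  [/\ #|W| = s - 2, W \subset N u :&: N v
    & k_connected k (del_edges G (star_edges W))].
Proof.
move=> Gk; have [kT _] := order_large.
have [C CN Ct] := subset_of_card common_neighbours.
have [|m [msym mG mm mcross]] := @weak_pairs_matching T G k t d 0 u v C
  ht hk hn_small hn_large hd hdeg _ isT G Gk; first by rewrite Ct addn0.
pose P := [set y | m u y] :|: [set y | m v y].
have [|W WC Ws] := @subset_of_card T (C :\: P) (s - 2).
  have := leq_of_leqif (leq_card_setU [set y | m u y] [set y | m v y]).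
  have := subset_leq_card (subsetIr C P); have := cardsID P C.
  have := matching_degree u mm; have := matching_degree v mm.
  by rewrite -/P Ct; move: st; clear; lia.
have WN : W \subset N u :&: N v.
  exact: subset_trans WC (subset_trans (subsetDl _ _) CN).
have uvW x := @notin_star W x WN.
exists W; split=> //.
apply: (@k_connected_of_sparse_removal T G k 0 u v C _ (star_adj W) m) => //.
- exact: star_adj_sym.
- move=> x xn; apply: leq_trans (_ : #|[set u; v]| <= 2); last by rewrite cards2; case: (_ != _).
  apply: subset_leq_card; apply/subsetP=> y.
  by rewrite inE /star_adj (negPf xn) => /andP[].
- move=> x xuv; rewrite leqn0 cards_eq0; apply/eqP/setP=> y; rewrite !inE.
  rewrite /star_adj (negPf (uvW _ xuv)) andbF orbF xuv /=.
  apply/negP=> /andP[yC /(subsetP WC)]; by rewrite !inE (negPf yC) andbF.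
- move=> x y xy; rewrite /= /del_edges_adj xy /= negbK star_edgesE //.
move=> x y mxy; rewrite /= /del_edges_adj mG //= star_edgesE.
have noP a b : m a b -> a \in [set u; v] -> b \in W -> False.
  move=> ab auv /(subsetP WC); rewrite !inE negb_or => /andP[/andP[/negP n1 /negP n2] _].
  by move: auv; rewrite !inE => /orP[] /eqP ea; [apply: n1|apply: n2]; rewrite -ea.
apply/negP=> /orP[] /andP[]; first exact: noP.
by apply: noP; rewrite msym.
Qed.

Definition used_adj (W : {set T}) (q : seq T) : rel T :=
  fun x y => [|| (x, y) \in steps u q, (y, x) \in steps u q | star_adj W x y].

Section Routing.
Variables (W : {set T}) (m : rel T).
Hypotheses (Ws : #|W| = s - 2) (WN : W \subset N u :&: N v).
Hypotheses (msym : symmetric m) (mm : forall x y z, m x y -> m x z -> y = z).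

Let e : rel T := fun x y => adj G x y && ~~ m x y.
(* The end of the walk: it is closed unless [s = 1]. *)
Let z := if s == 1 then v else u.
Let R := enum (~: (W :|: [set u; z])).

Lemma neighbour_count x (r : seq T) (X : {set T}) :
  uniq r -> (forall y, y \notin X -> y \in r) -> d <= count (e x) r + #|X| + 1.
Proof.
move=> ur rX; have -> : count (e x) r = #|[set y in r | e x y]|.
  rewrite -size_filter -(card_uniqP (filter_uniq _ ur)); apply: eq_card => y.
  by rewrite inE mem_filter andbC.
apply: leq_trans (hdeg x) _; rewrite /degree.
have sub : N x \subset [set y in r | e x y] :|: (X :|: [set y | m x y]).
  apply/subsetP=> y; rewrite !inE /e => ->; have [//|/rX->/=] := boolP (y \in X).
    by rewrite orbT.
  by case: (m x y).
apply: leq_trans (subset_leq_card sub) _.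
apply: leq_trans (leq_of_leqif (leq_card_setU _ _)) _; rewrite -addnA leq_add2l.
apply: leq_trans (leq_of_leqif (leq_card_setU _ _)) _; rewrite leq_add2l.
exact: matching_degree.
Qed.

(** For [s >= 2] the walk is a Hamiltonian cycle of [G - W] through [u]; for
    [s = 1] it is a Hamiltonian path from [u] to [v].  Each vertex loses at
    most one neighbour to [m] and [|W|] to [W], hence keeps at least
    [d - 1 - (s - 2)], at least half of the order [n - (s - 2)] of [G - W] when
    [s >= 2].  For [s = 1] one further neighbour, an end of the walk, goes
    uncounted. *)
Lemma spanning_walk : exists q,
  [/\ path e u q, last u q = z, uniq q, uniq (belast u q)
    & forall y, (y \in q) = (y \notin W :|: [set u; z]) || (y == z)].
Proof.
have [_ nT] := order_large.
have zW : z \notin W by rewrite (notin_star WN) // /z !inE; case: ifP; rewrite eqxx ?orbT.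
have uW : u \notin W by rewrite (notin_star WN) // !inE eqxx.
have cardR : size R + #|W| + (s == 1) + 1 = #|T|.
  rewrite -cardE; have := cardsC (W :|: [set u; z]).
  have -> : #|W :|: [set u; z]| = #|W| + (s == 1) + 1.
    have := leq_card_setU W [set u; z]; case=> _.
    have -> : [disjoint W & [set u; z]].
      apply/pred0P=> y /=; rewrite !inE; apply/negP=> /andP[yW /orP[]/eqP yE].
        by rewrite -yE yW in uW.
      by rewrite -yE yW in zW.
    by move/eqP->; rewrite cards2 /z; case: ifP => _; rewrite ?uv ?eqxx; clear; lia.
  clear; lia.
have uR : u \notin R by rewrite mem_enum !inE eqxx orbT.
have zR : z \notin R by rewrite mem_enum !inE eqxx !orbT.
have eR : uniq R by apply: enum_uniq.
have esym : symmetric e by move=> x y; rewrite /e adj_sym msym.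
have eirr : irreflexive e by move=> x; rewrite /e adj_irrefl.
have [|q [pq lq pa]] := @ore_walk T e esym eirr u (rcons R z).
  move=> x y; rewrite belast_rcons size_rcons.
  (* For [s = 1] each of the two lists of vertices lacks one end of the walk. *)
  pose X a := W :|: [set c in [set a] | s == 1].
  have cX a : #|X a| <= #|W| + (s == 1).
    apply: leq_trans (leq_of_leqif (leq_card_setU _ _)) _; rewrite leq_add2l.
    case: (s == 1); last by rewrite leqn0 cards_eq0; apply/eqP/setP=> c; rewrite !inE andbF.
    by rewrite (_ : [set c in _ | true] = [set a]) ?cards1 //; apply/setP=> c; rewrite !inE andbT.
  have cx : d <= count (e x) (u :: R) + #|X z| + 1.
    apply: neighbour_count; first by rewrite /= uR.
    move=> c; rewrite !inE mem_enum !inE /z; case: (s == 1); rewrite ?andbT ?andbF;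
    by case: (c \in W); case: (c == u); case: (c == v).
  have cy : d <= count (e y) (rcons R z) + #|X u| + 1.
    apply: neighbour_count; first by rewrite rcons_uniq zR.
    move=> c; rewrite mem_rcons !inE mem_enum !inE /z; case: (s == 1); rewrite ?andbT ?andbF;
    by case: (c \in W); case: (c == u); case: (c == v).
  have := cX z; have := cX u; move: cx cy; move: cardR Ws hd s0 st ht.
  by move: (count _ (_ :: _)) (count _ (rcons _ _)) #|X u| #|X z| (size R) #|W| #|T|;
    case: eqP => [->|]; clear; lia.
exists q; rewrite last_rcons in lq; split=> //.
- by rewrite (perm_uniq pq) rcons_uniq zR.
- have := perm_belast (u := u) pq; rewrite last_rcons => /(_ lq)/perm_uniq ->.
  by rewrite belast_rcons /= uR.
by move=> y; rewrite (perm_mem pq) mem_rcons inE mem_enum !inE orbC.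
Qed.

(** The walk of [spanning_walk] is cut at [v], its second part is reversed, and
    the paths through [W] are added.  The two parts differ because the cycle
    has at least three vertices. *)
Lemma path_system : exists q (Ps : seq (seq T)),
  [/\ path e u q, uniq q, uniq (belast u q), {in u :: q, forall x, x \notin W} &
   [/\ size Ps = s, uniq Ps, all (is_path G u v) Ps,
      pairwise (fun p1 p2 => path_vertices p1 :&: path_vertices p2 \subset [set u; v]) Ps
    & (forall x, exists2 p, p \in Ps & x \in p) /\
      (forall p, p \in Ps -> exists2 r, p = u :: r &
         forall a b, (a, b) \in steps u r -> used_adj W q a b)]].
Proof.
have [q [pa lq uq ubq qW]] := spanning_walk.
have uW : u \notin W by rewrite (notin_star WN) // !inE eqxx.
have vW : v \notin W by rewrite (notin_star WN) // !inE eqxx orbT.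
have paG : path (adj G) u q by apply: sub_path pa => x y /andP[].
have WqF : {in u :: q, forall x, x \notin W}.
  move=> x; rewrite inE qW !inE /z => /or3P[/eqP->//||/eqP->].
    by rewrite !negb_or => /andP[].
  by case: ifP.
exists q; have [s1|s1] := eqVneq s 1.
  have W0 : W = set0 by apply/eqP; rewrite -cards_eq0 Ws s1.
  have zv : z = v by rewrite /z s1.
  exists [:: u :: q]; split=> //; split=> //=.
  - rewrite paG lq zv !eqxx uq /= !andbT qW zv !inE eqxx orbT /=.
    by rewrite (negPf uv).
  - split=> [x|p]; last first.
      by rewrite inE => /eqP->; exists q => // a b ab; rewrite /used_adj ab.
    exists (u :: q); first exact: mem_head.
    rewrite inE qW W0 zv !inE /=.
    by case: (x == u); case: (x == v).
have zu : z = u by rewrite /z (negPf s1).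
rewrite zu in lq.
have vq : v \in q by rewrite qW zu !inE (negPf vW) eq_sym (negPf uv).
have sq : 2 < size q.
  have : #|~: W| <= size q.
    rewrite -(card_uniqP uq); apply: subset_leq_card; apply/subsetP=> x.
    rewrite inE qW zu !inE => /negPf->; by case: (x == u).
  have [_] := order_large; have := cardsC W; rewrite Ws; move: s0 s1; clear; lia.
case/splitPr: vq => q1 q2 in lq uq ubq qW pa paG WqF sq *.
have {}lq : last v q2 = u by rewrite last_cat in lq.
have uq2 : u \in q2.
  by move: lq; case: (q2) => [/eqP|y r /= <-]; rewrite ?mem_last // eq_sym (negPf uv).
move: uq; rewrite cat_uniq /= => /and3P[uq1 /norP[vq1 /hasPn dq] /andP[vq2 uq2']].
have uq1' : u \notin q1 by apply: dq.
pose p1 := u :: rcons q1 v; pose p2 := u :: rev (belast v q2).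
have p2E : p2 = rev (v :: q2) by rewrite lastI rev_rcons lq.
pose ws := [seq [:: u; w; v] | w <- enum W].
have inq x : x \in p1 \/ x \in p2 -> x \notin W.
  rewrite p2E mem_rev => xp; apply: WqF; move: xp.
  by rewrite !(inE, mem_rcons, mem_cat) => -[/or3P[]|/orP[]] ->; rewrite ?orbT.
have p12 x : x \in p1 -> x \in p2 -> x \in [set u; v].
  rewrite p2E mem_rev !(inE, mem_rcons) => /or3P[->//|->|xq1]; first by rewrite orbT.
  case/orP=> [->|/dq]; first by rewrite orbT.
  by rewrite /= xq1.
have wsP p : p \in ws -> exists2 w, w \in W & p = [:: u; w; v].
  by case/mapP=> w; rewrite mem_enum; exists w.
have pws p : p \in ws -> p != p1 /\ p != p2.
  case/wsP=> w wW ->; split; apply: contraL wW => /eqP pE; apply: inq.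
    by left; rewrite -pE !inE eqxx orbT.
  by right; rewrite -pE !inE eqxx orbT.
exists [:: p1, p2 & ws]; split=> //.
  by rewrite uq1 negb_or vq1 vq2 uq2' !andbT; apply/hasPn.
split.
- by rewrite /= size_map -cardE Ws; move: s0 s1; clear; lia.
- rewrite /= map_inj_uniq ?enum_uniq ?andbT; last by move=> w w' [].
  rewrite inE !negb_or; apply/andP; split; last first.
    by apply/negP=> /pws[_]; rewrite eqxx.
  apply/andP; split; last by apply/negP=> /pws[]; rewrite eqxx.
  apply: contraTneq sq => p1E; rewrite -leqNgt.
  have q10 : size q1 = 0.
    apply/eqP; rewrite -leqn0 leqNgt -has_predT; apply/hasP=> -[x xq1 _].
    have xp1 : x \in p1 by rewrite inE mem_rcons inE xq1 !orbT.
    have : x \in [set u; v] by apply: p12; rewrite -?p1E.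
    rewrite !inE => /orP[]/eqP xE; first by rewrite -xE xq1 in uq1'.
    by rewrite -xE xq1 in vq1.
  have := congr1 size p1E; rewrite /= size_rcons size_rev size_belast size_cat /= q10.
  by clear; lia.
- apply/and3P; split.
  + rewrite /= eqxx last_rcons eqxx /= rcons_uniq vq1 uq1 mem_rcons inE negb_or uv uq1' /= andbT.
    by move: paG; rewrite cat_path rcons_path /= => /and3P[-> ->].
  + have -> : is_path G u v p2 = [&& u == u, last u (rev (belast v q2)) == v,
      path (adj G) u (rev (belast v q2)) & uniq p2] by [].
    rewrite p2E rev_uniq /= vq2 uq2' andbT eqxx /=.
    rewrite -lq last_rev_belast eqxx /= rev_path.
    move: paG; rewrite cat_path /= => /and3P[_ _].
    by rewrite andbT (eq_path (e' := adj G)) // => x y; rewrite adj_sym.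
  apply/allP=> p /wsP[w wW ->] /=; have := subsetP WN _ wW; rewrite !inE !eqxx /=.
  case/andP=> -> vw; rewrite adj_sym vw /= !andbT negb_or uv andbT.
  by apply/andP; split; [apply: contraNneq uW => ->|apply: contraNneq vW => <-].
- have pw p w : (forall x, x \in p -> x \notin W) -> w \in W ->
      path_vertices p :&: path_vertices [:: u; w; v] \subset [set u; v].
    move=> pW wW; apply/subsetP=> x; rewrite !inE => /andP[/pW xW].
    case/or3P=> [->|/eqP xw|->]; rewrite ?orbT //; by rewrite xw wW in xW.
  rewrite /= !pairwise_map; apply/and3P; split.
  + apply/andP; split.
      apply/subsetP=> x /setIP[xp1 xp2].
      by apply: p12; [move: xp1|move: xp2]; rewrite /path_vertices in_set.
    by apply/allP=> p /wsP[w wW ->]; apply: pw => // x xp; apply: inq; left.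
  + by apply/allP=> p /wsP[w wW ->]; apply: pw => // x xp; apply: inq; right.
  have : uniq (enum W) by apply: enum_uniq.
  rewrite uniq_pairwise; apply: sub_pairwise => w w' /= ww'.
  apply/subsetP=> x; rewrite !inE => /andP[/or3P[->|/eqP->|->]]; rewrite ?orbT //.
  by rewrite (negPf ww').
split=> [x|p].
  have [xW|xW] := boolP (x \in W).
    exists [:: u; x; v]; last by rewrite !inE eqxx orbT.
    by rewrite !inE; apply/orP; right; apply/orP; right; apply: map_f; rewrite mem_enum.
  have : x \in q1 ++ v :: q2 by rewrite qW zu !inE (negPf xW); case: (x == u).
  rewrite mem_cat => /orP[xq1|xq2].
    by exists p1; rewrite !inE ?eqxx // mem_rcons inE xq1 !orbT.
  by exists p2; rewrite ?p2E ?mem_rev // -p2E mem_behead ?mem_head.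
rewrite 2!inE => /or3P[/eqP->|/eqP->|/wsP[w wW ->]].
- exists (rcons q1 v) => // a b ab; rewrite /used_adj -cat_rcons steps_cat mem_cat ab //.
- exists (rev (belast v q2)) => // a b; rewrite -lq steps_rev mem_rev.
  case/mapP=> -[c c'] cq [-> ->] /=.
  by rewrite /used_adj -cat_rcons steps_cat !mem_cat last_rcons cq !orbT.
exists [:: w; v] => // a b; rewrite !inE => /orP[]/eqP[-> ->];
  by rewrite /used_adj /star_adj !inE wW !eqxx !orbT.
Qed.

End Routing.

Lemma used_adj_sym W q : symmetric (used_adj W q).
Proof. by move=> x y; rewrite /used_adj star_adj_sym orbCA. Qed.

Lemma steps_card (X : {set T}) q x : uniq q -> uniq (belast u q) ->
  {in X, forall y, ((x, y) \in steps u q) || ((y, x) \in steps u q)} -> #|X| <= 2.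
Proof.
move=> uq ubq Xst; rewrite cardE; apply: (steps_neighbours ubq uq (enum_uniq _)) => y.
by rewrite mem_enum inE; apply: Xst.
Qed.

(** Inside the graph of [star_removal] the weak pairs for [D = W] and [e = 2]
    contain the sides of every separation that the deleted edges can create:
    a vertex of [W] loses its edges to [u] and [v], and any other vertex at
    most two edges of the walk besides those to [W]. *)
Lemma path_system_k_connected : k_connected k G ->
  exists P : 'I_s -> seq T,
    [/\ injective P,
        forall i : 'I_s, is_path G u v (P i),
        internally_disjoint u v P,
        \bigcup_(i < s) path_vertices (P i) = [set: T]
      & k <= kappa (del_edges G (\bigcup_(i < s) path_edges (P i)))].
Proof.
move=> Gk; have [kT _] := order_large.
have [W [Ws WN G1k]] := star_removal Gk.
have uvW x := @notin_star W x WN.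
have De : #|W| + 2 <= t by rewrite Ws; move: st ht; clear; lia.
have [m [msym mG1 mm mcross]] := @weak_pairs_matching T G k t d 2 u v W
  ht hk hn_small hn_large hd hdeg De (leqnn 2) _ G1k.
have [q [Ps [pa uq ubq qW [sPs uPs paths dis [cover used]]]]] :=
  path_system Ws WN msym mm.
pose P (i : 'I_s) := nth [::] Ps i.
have PPs i : P i \in Ps by rewrite mem_nth // sPs.
exists P; split.
- move=> i j /eqP; rewrite /P nth_uniq ?sPs // => /eqP; exact: val_inj.
- by move=> i; apply: (allP paths).
- have ltd (i j : 'I_s) : i < j -> path_vertices (P i) :&: path_vertices (P j) \subset [set u; v].
    by move=> ij; apply: (pairwiseP [::] dis) ij; rewrite inE sPs.
  move=> i j; rewrite neq_ltn => /orP[|ji]; first exact: ltd.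
  by rewrite setIC; apply: ltd.
- apply/setP=> x; rewrite inE; apply/bigcupP; have [p pP xp] := cover x.
  have ip : index p Ps < s by rewrite -sPs index_mem.
  by exists (Ordinal ip) => //; rewrite inE /P nth_index.
set F := \bigcup_(i < s) _.
have Fused x y : [set x; y] \in F -> used_adj W q x y.
  case/bigcupP=> i _; have [r ->] := used _ (PPs i); move=> rused.
  case/imsetP=> -[a b]; rewrite -[zip _ _]/(zip (u :: r) r) -steps_zip => /rused ab.
  by case/set2_inj=> -[-> ->]; rewrite //= used_adj_sym.
have stepW x y : (x, y) \in steps u q -> x \notin W /\ y \notin W.
  move=> xy; split; apply: qW; last first.
    by rewrite inE -[q in X in _ || X](steps_snd u q); apply/orP; right; apply: (map_f snd xy).
  apply: mem_belast; rewrite -(steps_fst u q); exact: (map_f fst xy).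
have stepm x y : (x, y) \in steps u q -> ~~ m x y.
  by move: pa; rewrite path_steps => /allP pa /pa /andP[].
apply: (@k_connected_of_sparse_removal T G k 2 u v W _ (used_adj W q) m) => //.
- exact: used_adj_sym.
- move=> x xn; have [xW|xW] := boolP (x \in W).
    apply: leq_trans (_ : #|[set u; v]| <= 2); last by rewrite cards2; case: (_ != _).
    apply: subset_leq_card; apply/subsetP=> y; rewrite inE /used_adj.
    case/or3P=> [/stepW[]|/stepW[]|]; rewrite ?xW //.
    by rewrite /star_adj (negPf xn) => /andP[].
  apply: (steps_card (x := x) uq ubq) => y.
  by rewrite inE /used_adj /star_adj (negPf xn) (negPf xW) andbF /= orbF.
- move=> x xuv; apply: (steps_card (x := x) uq ubq) => y.
  rewrite !in_setD in_set /used_adj /star_adj (negPf (uvW _ xuv)) andbF orbF.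
  by case: (y \in W); rewrite ?andbF ?orbF.
- by move=> x y xy; rewrite /= /del_edges_adj xy negbK => /Fused.
move=> x y xy; have := mG1 _ _ xy; rewrite /= /del_edges_adj star_edgesE.
case/andP=> -> nst /=; apply: contraL xy => /Fused /or3P[/stepm//||st'].
  by rewrite msym => /stepm.
by rewrite st' in nst.
Qed.

End PathSystem.

Lemma min_degree_leq (T : finType) (G : sgraph T) x : min_degree G <= degree G x.
Proof.
rewrite /min_degree; have : x \in index_enum T by apply: mem_index_enum.
elim: (index_enum T) => // y r IHr; rewrite inE big_cons => /orP[/eqP<-|/IHr].
  exact: geq_minl.
exact/leq_trans/geq_minr.
Qed.

Theorem theorem1p6 (k t : nat) (T : finType) (G : sgraph T)
  (hk : 2 <= k) (ht : 3 <= t)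
  (Gconn : k_connected k G)
  (hn_small : 3 <= t <= k + 1 -> 6 * k + 9 - 3 * t <= #|T|)
  (hn_large : k + 2 <= t -> 2 * k + t + 3 <= #|T|)
  (hdelta : uphalf (#|T| + t) <= min_degree G) :
  forall (u v : T) (s : nat), u != v -> 1 <= s <= t ->
  exists P : 'I_s -> seq T,
    [/\ injective P,
        forall i : 'I_s, is_path G u v (P i),
        internally_disjoint u v P,
        \bigcup_(i < s) path_vertices (P i) = [set: T]
      & k <= kappa (del_edges G (\bigcup_(i < s) path_edges (P i)))].
Proof.
move=> u v s uv /andP[s0 st].
apply: (@path_system_k_connected T G k t (min_degree G) s u v) => //.
- move=> tk; have := hn_small; rewrite ht tk => /(_ isT); clear; lia.
- by rewrite mul2n -leq_uphalf_double.
exact: min_degree_leq.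
Qed.
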